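(* Let $Q$ be a finite connected rack. The following are equivalent: (i) $Q$ is medial. (ii) $Q$ is abelian. (iii) $Q\cong \mathrm{Aff}(A,1-f,f,0)\times(\mathbb{Z}_n,+1)$ for some abelian group $A$, some $f\in\mathrm{Aut}(A)$ with $\mathrm{Fix}(f)=0$, and some $n\geq 1$.
   Context: A left quasigroup is a (nonempty) set $Q$ with a binary operation $*$ such that every $L_x:y\mapsto x*y$ is a bijection (with $x\backslash y=L_x^{-1}(y)$, also regarded as a basic operation). It is a rack if $x*(y*z)=(x*y)*(x*z)$ for all $x,y,z$; medial if $(x*y)*(z*u)=(x*z)*(y*u)$ for all $x,y,z,u$; connected if $\mathrm{LMlt}(Q)=\langle L_a:a\in Q\rangle$ is transitive on $Q$. For an abelian group $A$, $g\in\mathrm{End}(A)$, $f\in\mathrm{Aut}(A)$, $c\in A$, $\mathrm{Aff}(A,g,f,c)$ is $A$ with $a*b=g(a)+f(b)+c$. $(\mathbb{Z}_n,+1)$ is the left quasigroup on $\mathbb{Z}_n$ with $a*b=b+1$. $\mathrm{Fix}(f)=\{a\in A: f(a)=a\}$. $Q$ is abelian in the sense of commutator theory: for every $(k+1)$-ary term operation $t$ (in $*,\backslash$) and all $a,b,u_1,\ldots,u_k,v_1,\ldots,v_k\in Q$, $t(a,u_1,\ldots,u_k)=t(a,v_1,\ldots,v_k)$ implies $t(b,u_1,\ldots,u_k)=t(b,v_1,\ldots,v_k)$. *)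

(* Defs.v *)
From HB Require Import structures.
From mathcomp Require Import all_boot all_order all_algebra all_fingroup.

Set Implicit Arguments.
Unset Strict Implicit.
Unset Printing Implicit Defensive.

Import GRing.Theory.
Local Open Scope ring_scope.

(* [ldiv x y] stands for x \ y; the two cancellation laws say exactly that
   [mul x] is bijective with inverse [ldiv x], so [ldiv] is determined by
   [mul]. *)
Definition left_quasigroup (Q : Type) (mul ldiv : Q -> Q -> Q) : Prop :=
  inhabited Q /\
  forall x, cancel (mul x) (ldiv x) /\ cancel (ldiv x) (mul x).

Definition rack (Q : Type) (mul ldiv : Q -> Q -> Q) : Prop :=
  left_quasigroup mul ldiv /\
  forall x y z, mul x (mul y z) = mul (mul x y) (mul x z).

Definition medial (Q : Type) (mul : Q -> Q -> Q) : Prop :=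
  forall x y z u, mul (mul x y) (mul z u) = mul (mul x z) (mul y u).

(* The generators are the permutations that coincide with some left
   translation; in a left quasigroup every left translation is one. *)
Definition LMlt (Q : finType) (mul : Q -> Q -> Q) : {group {perm Q}} :=
  <<[set s : {perm Q} | [exists a, [forall y, s y == mul a y]]]>>%G.

Definition connected (Q : finType) (mul : Q -> Q -> Q) : Prop :=
  [transitive LMlt mul, on [set: Q] | 'P].

Inductive term (k : nat) : Type :=
| Var of 'I_k
| Mul of term k & term k
| Ldiv of term k & term k.

Fixpoint eval (Q : Type) (mul ldiv : Q -> Q -> Q) (k : nat)
    (e : k.-tuple Q) (t : term k) : Q :=
  match t with
  | Var i => tnth e i
  | Mul t1 t2 => mul (eval mul ldiv e t1) (eval mul ldiv e t2)
  | Ldiv t1 t2 => ldiv (eval mul ldiv e t1) (eval mul ldiv e t2)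
  end.

(* Abelianness in the sense of commutator theory, not commutativity. *)
Definition abelian_alg (Q : Type) (mul ldiv : Q -> Q -> Q) : Prop :=
  forall (k : nat) (t : term k.+1) (a b : Q) (u v : k.-tuple Q),
    eval mul ldiv [tuple of a :: u] t = eval mul ldiv [tuple of a :: v] t ->
    eval mul ldiv [tuple of b :: u] t = eval mul ldiv [tuple of b :: v] t.

Definition aff (A : zmodType) (g f : {additive A -> A}) (c : A) (a b : A) : A :=
  g a + f b + c.

Definition Fix (A : zmodType) (f : {additive A -> A}) : {pred A} :=
  [pred a | f a == a].

(* Z_n is carried by ['I_n], with [ordS b] = b + 1 mod n, because ['Z_1] is
   not the trivial group. *)
Definition Zn_succ (n : nat) (a b : 'I_n) : 'I_n := ordS b.

Definition prod_op (P Q : Type) (mulP : P -> P -> P) (mulQ : Q -> Q -> Q)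
    (x y : P * Q) : P * Q :=
  (mulP x.1 y.1, mulQ x.2 y.2).

(* Between left quasigroups, a bijection preserving * also preserves \. *)
Definition isomorphic (P Q : Type) (mulP : P -> P -> P) (mulQ : Q -> Q -> Q) :
    Prop :=
  exists h : P -> Q, bijective h /\ forall x y, h (mulP x y) = mulQ (h x) (h y).

(* Main.v *)
Require Import Defs.
From HB Require Import structures.
From mathcomp Require Import all_boot all_order all_algebra all_fingroup.

Set Implicit Arguments.
Unset Strict Implicit.
Unset Printing Implicit Defensive.

(* In a rack, (x*y)*(z*u) and (x*z)*(y*u) agree at x = y, so abelianness makes
   them agree everywhere.  Conversely, let Q be connected and medial, and let D
   be the displacement group, generated by the L_x^-1 L_y.  Mediality makes D
   abelian.  The squaring map x |-> x*x is injective, commutes with all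
   automorphisms and satisfies L_(x*x) = L_x; as L_x x = x*x, conjugation by
   L_x preserves the stabiliser of x in D, which is thus normal in the
   transitive group LMlt(Q), hence trivial.  All the L_y are D-conjugate to
   L_(x0), so d |-> [d, L_(x0)] maps D onto D and is therefore injective:
   conjugation by L_(x0) fixes only 1.  It follows that
   (d, i) |-> d (square^i x0) is a bijection from D x Z_n onto Q, where n is
   the order of x0 under squaring, and this is the isomorphism sought.
   Finally, (iii) is an affine representation of Q over A x Z_n, which forces
   abelianness. *)

Import GRing.Theory.
Local Open Scope ring_scope.

(** * Abelianness, mediality and affine representations *)

Lemma rack_abelian_medial (Q : Type) (mul ldiv : Q -> Q -> Q) :
  rack mul ldiv -> abelian_alg mul ldiv -> medial mul.
Proof.
move=> [[_ mulK] selfd] abQ x y z u.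
pose X i : term 4 := Var (inord i).
pose t := Mul (Mul (X 0%N) (X 1%N)) (Mul (X 2) (X 3)).
have evalt (a b c d : Q) :
    eval mul ldiv [tuple of a :: [tuple b; c; d]] t
    = mul (mul a b) (mul c d).
  by rewrite /= !(tnth_nth a) /= !inordK.
have := abQ _ t y x [tuple y; z; u] [tuple z; y; u].
rewrite !evalt; apply.
(* Both sides equal [mul y (mul z u)]: on the left, [mul z u] is first written as [mul y w], so that
   self-distributivity applies. *)
by rewrite -selfd -[mul z u](proj2 (mulK y)) -selfd.
Qed.

(* By induction on the term, the difference of its values at two tuples of
   parameters does not depend on the remaining argument. *)
Lemma affine_abelian (Q : Type) (mul ldiv : Q -> Q -> Q) (V : zmodType)
    (g f : {additive V -> V}) (c : V) (h : Q -> V) :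
    left_quasigroup mul ldiv -> injective h -> injective f ->
    (forall x y, h (mul x y) = aff g f c (h x) (h y)) ->
  abelian_alg mul ldiv.
Proof.
move=> [_ mulK] h_inj f_inj hM k t a b u v.
pose d s w := h (eval mul ldiv [tuple of w :: u] s)
              - h (eval mul ldiv [tuple of w :: v] s).
have affB (x y x' y' : V) :
    aff g f c x y - aff g f c x' y' = g (x - x') + f (y - y').
  by rewrite /aff opprD addrACA subrr addr0 opprD addrACA !raddfB.
suffices dE : d t a = d t b.
  move=> /(congr1 h) /eqP; rewrite -subr_eq0 -/(d t a) dE subr_eq0.
  by move=> /eqP /h_inj.
elim: t => [i | s IHs t IHt | s IHs t IHt].
- rewrite /d /=; case: (unliftP ord0 i) => [j ->|->].
    by rewrite !tnthS.
  by rewrite !tnth0 !subrr.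
- by rewrite /d /= !hM !affB -!/(d _ _) IHs IHt.
(* The identity s * (s \ t) = t determines the difference for [Ldiv s t], as [f] is injective. *)
have dM w : g (d s w) + f (d (Ldiv s t) w) = d t w.
  by rewrite /d -affB -!hM /= !(proj2 (mulK _)).
by apply/f_inj/(addrI (g (d s a))); rewrite dM [in RHS]IHs dM.
Qed.

Lemma prod_aff_abelian (Q : Type) (mul ldiv : Q -> Q -> Q) (A : zmodType)
    (f : {additive A -> A}) (n : nat) :
    left_quasigroup mul ldiv -> injective f -> (0 < n)%N ->
    isomorphic mul (prod_op (aff (idfun \- f) f 0) (@Zn_succ n)) ->
  abelian_alg mul ldiv.
Proof.
case: n => // n mulQ f_inj _ [h [h_bij hM]].
(* Over [A * 'I_n.+1] the product is affine: [G] kills the cyclic coordinate, [F] keeps it, and the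
   constant [(0, ordS ord0)] adds 1 to it, even modulo 1. *)
pose G (x : A * 'I_n.+1) : A * 'I_n.+1 := (x.1 - f x.1, 0).
pose F (x : A * 'I_n.+1) : A * 'I_n.+1 := (f x.1, x.2).
have G_add : zmod_morphism G.
  move=> x y; congr pair; rewrite /= ?subr0 //.
  by rewrite raddfB opprD addrACA -opprD.
have F_add : zmod_morphism F by move=> x y; congr pair; rewrite /= raddfB.
pose Ga : {additive _ -> _} :=
  HB.pack G (GRing.isZmodMorphism.Build _ _ G G_add).
pose Fa : {additive _ -> _} :=
  HB.pack F (GRing.isZmodMorphism.Build _ _ F F_add).
apply: (@affine_abelian _ _ _ _ Ga Fa (0, ordS ord0) h) => //.
- exact: bij_inj.
- by move=> [x i] [y j] [/f_inj -> ->].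
move=> x y; rewrite hM; congr pair => //=.
by rewrite add0r; apply: val_inj; rewrite /= modnDmr addn1.
Qed.

(** * Abelian subgroups as additive groups *)

Section AbelianSubgroup.

Variables (gT : finGroupType) (D : {group gT}).

(** The type carries the proof of commutativity, which its additive structure needs. *)
Definition abelian_zmod of abelian D : Type := subg_of D.

Variable cDD : abelian D.
Local Notation A := (abelian_zmod cDD).

HB.instance Definition _ := Choice.on A.

Let mulgC (x y : A) : (x * y = y * x :> subg_of D)%g.
Proof. by apply: val_inj; apply: (centsP cDD); apply: valP. Qed.

HB.instance Definition _ := GRing.isZmodule.Build A
  (@mulgA (subg_of D)) mulgC (@mul1g (subg_of D)) (@mulVg (subg_of D)).

Lemma sgvalD (x y : A) : sgval (x + y) = (sgval x * sgval y)%g.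
Proof. by []. Qed.

Lemma sgvalN (x : A) : sgval (- x) = (sgval x)^-1%g.
Proof. by []. Qed.

Variable s : gT.
Hypothesis nDs : s \in 'N(D)%g.

Definition conj_zmod (x : A) : A := subg D (sgval x ^ s)%g.

Lemma sgval_conj (x : A) : sgval (conj_zmod x) = (sgval x ^ s)%g.
Proof. by rewrite subgK // memJ_norm // subgP. Qed.

Lemma conj_zmod_additive : zmod_morphism conj_zmod.
Proof.
move=> x y; apply: subg_inj.
by rewrite sgvalD sgvalN !sgval_conj sgvalD sgvalN conjMg conjVg.
Qed.

Lemma conj_zmod_bij : bijective conj_zmod.
Proof.
apply: injF_bij => x y /(congr1 (@sgval _ _)); rewrite !sgval_conj.
by move=> /conjg_inj; apply: subg_inj.
Qed.

End AbelianSubgroup.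

(** * Left translations, squaring and displacements *)

Section LeftTranslations.

Variables (Q : finType) (mul ldiv : Q -> Q -> Q).
Hypothesis mulQ : rack mul ldiv.

Local Open Scope group_scope.

Definition ltr_of (mulK : left_quasigroup mul ldiv) (x : Q) : {perm Q} :=
  perm (can_inj (proj1 (proj2 mulK x))).
Local Notation ltr := (ltr_of (proj1 mulQ)).

Lemma ltrE x y : ltr x y = mul x y.
Proof. by rewrite permE. Qed.

(** Permutations compose from left to right, so [ltr y ^ ltr x] is the map L_x L_y L_x^-1. *)
Lemma ltr_mul x y : ltr (mul x y) = ltr y ^ ltr x.
Proof.
apply: (mulgI (ltr x)); rewrite -conjgC; apply/permP=> z.
by rewrite !permM !ltrE -(proj2 mulQ).
Qed.

Definition square x := mul x x.

Lemma ltr_square x : ltr (square x) = ltr x.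
Proof. by rewrite ltr_mul conjgE mulKg. Qed.

Lemma ltr_iter_square i x : ltr (iter i square x) = ltr x.
Proof. by elim: i => //= i; rewrite ltr_square. Qed.

(** Equal squares force equal left translations, and this common injective map sends both points to
    the same square. *)
Lemma square_inj : injective square.
Proof.
move=> x y eq_sq; apply: (@perm_inj _ (ltr x)); rewrite ltrE.
have eq_ltr : ltr x = ltr y by rewrite -ltr_square eq_sq ltr_square.
by rewrite eq_ltr ltrE.
Qed.

(** The condition s(x * y) = s(x) * s(y), read as an identity of permutations in y. *)
Definition rack_aut : {set {perm Q}} :=
  [set s : {perm Q} | [forall x, ltr (s x) == ltr x ^ s]].

Lemma group_set_rack_aut : group_set rack_aut.
Proof.
apply/group_setP; split=> [|s t]; rewrite !inE.
  by apply/forallP=> x; rewrite perm1 conjg1.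
move=> /forallP sA /forallP tA; apply/forallP=> x.
by rewrite permM (eqP (tA _)) (eqP (sA _)) conjgM.
Qed.
Canonical rack_aut_group := Group group_set_rack_aut.

Lemma rack_autP s x : s \in rack_aut -> ltr (s x) = ltr x ^ s.
Proof. by rewrite inE => /forallP/(_ x)/eqP. Qed.

Lemma ltr_aut x : ltr x \in rack_aut.
Proof. by rewrite inE; apply/forallP=> y; rewrite ltrE ltr_mul. Qed.

Lemma iter_square_aut s i x :
  s \in rack_aut -> iter i square (s x) = s (iter i square x).
Proof.
move=> sA; elim: i => //= i ->.
by rewrite /square -!ltrE (rack_autP _ sA) permJ.
Qed.

Definition displ_gens := [set (ltr p.1)^-1 * ltr p.2 | p : Q * Q].

Definition displ : {group {perm Q}} := [group of <<displ_gens>>].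

Lemma displ_gen x y : (ltr x)^-1 * ltr y \in displ.
Proof. by apply/mem_gen/imsetP; exists (x, y). Qed.

Lemma displ_aut : displ \subset rack_aut.
Proof.
rewrite gen_subG; apply/subsetP=> _ /imsetP[[x y] _ ->] /=.
by rewrite groupM ?groupV ?ltr_aut.
Qed.

Lemma ltr_norm x : ltr x \in 'N(displ).
Proof.
rewrite -sub1set norms_gen // sub1set inE.
apply/subsetP=> _ /imsetP[_ /imsetP[[y z] _ ->] ->].
apply/imsetP; exists (mul x y, mul x z) => //=.
by rewrite !ltr_mul conjMg conjVg.
Qed.

Lemma medial_abelian_displ : medial mul -> abelian displ.
Proof.
move=> mediQ.
(* Mediality read in its last variable. This swap of outer factors, together with its inverse form,
   exchanges two generators. *)
have ltrC x y z : ltr z * (ltr x)^-1 * ltr y = ltr y * (ltr x)^-1 * ltr z.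
  apply: (mulIg (ltr x)); rewrite -!mulgA -!conjgE -!ltr_mul.
  by apply/permP=> u; rewrite !permM !ltrE mediQ.
rewrite abelian_gen; apply/centsP=> _ /imsetP[[x y] _ ->] _ /imsetP[[z t] _ ->].
rewrite /commute /=; have := congr1 invg (ltrC t x z).
rewrite !invMg !invgK !mulgA => ltrVC.
by rewrite -ltrVC -!(mulgA (ltr x)^-1) ltrC.
Qed.

(** * Connected racks with abelian displacement group *)

Hypothesis Q_conn : connected mul.

Lemma connected_ind (P : pred Q) x0 :
  P x0 -> (forall a x, P x -> P (mul a x)) -> forall x, P x.
Proof.
move=> P0 PM x; have nP : LMlt mul \subset 'N([set x | P x] | 'P).
  rewrite gen_subG; apply/subsetP=> s; rewrite !inE => /existsP[a /forallP sa].
  by apply/subsetP=> y; rewrite !inE /= apermE (eqP (sa y)); apply: PM.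
have: x \in orbit 'P (LMlt mul) x0 by rewrite (atransP Q_conn) ?inE.
have: orbit 'P (LMlt mul) x0 \subset [set y | P y].
  by rewrite acts_sub_orbit ?inE.
by move=> /subsetP sP /sP; rewrite inE.
Qed.

Hypothesis displ_abel : abelian displ.

Lemma displ_semiregular s x : s \in displ -> s x = x -> s = 1.
Proof.
pose K := 'C_displ[x | 'P].
have Kx t : (t \in K) = (t \in displ) && (t x == x).
  by rewrite !inE /= sub1set inE.
have nK a : ltr a \in 'N(K).
  (* [t ^ ltr x] fixes [mul x x], hence [x], since as an automorphism it commutes with the injective
     squaring map. *)
  have nKx : ltr x \in 'N(K).
    rewrite inE; apply/subsetP=> _ /imsetP[t + ->]; rewrite !Kx.
    case/andP=> tD /eqP tx; rewrite memJ_norm ?ltr_norm //= tD.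
    have tA : t ^ ltr x \in rack_aut.
      by rewrite groupJ ?ltr_aut // (subsetP displ_aut).
    apply/eqP/square_inj; have /= -> := iter_square_aut 1 x tA.
    by rewrite /square -ltrE permJ tx.
  (* [ltr a] is [ltr x] times a displacement, and the abelian [displ] normalises its subgroup
     [K]. *)
  rewrite -(mulKVg (ltr x) (ltr a)) groupM //.
  apply: (subsetP (sub_abelian_norm displ_abel (subsetIl _ _))).
  exact: displ_gen.
suffices fixK y : [forall t in K, t y == y].
  move=> sD sx; apply/permP=> y; rewrite perm1; apply/eqP.
  by have /forall_inP := fixK y; apply; rewrite Kx sD sx /=.
apply: (@connected_ind (fun y => [forall t in K, t y == y]) x) y => [|a y fixy].
  by apply/forall_inP=> t; rewrite Kx => /andP[].
apply/forall_inP=> t tK; rewrite -ltrE.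
have /forall_inP/(_ (t ^ (ltr a)^-1)) := fixy.
rewrite memJ_norm ?groupV // => /(_ tK)/eqP ty.
by rewrite -{1}(conjgKV (ltr a) t) permJ ty.
Qed.

Lemma ltr_displ_conj x y : exists2 d, d \in displ & ltr y = ltr x ^ d.
Proof.
apply/imsetP.
apply: (@connected_ind (fun z => ltr z \in ltr x ^: displ) x) => [|a z].
  exact: class_refl.
case/imsetP=> d dD zE; rewrite ltr_mul zE -(mulKVg (ltr x) (ltr a)).
(* [d * ltr a] is [ltr x] times this witness, and [ltr x] centralises itself. *)
apply/imsetP; exists (d ^ ltr x * ((ltr x)^-1 * ltr a)).
  by rewrite groupM ?displ_gen // memJ_norm ?ltr_norm.
have ltrJ : ltr x ^ ltr x = ltr x by rewrite conjgE mulKg.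
by rewrite conjgM -(conjgM _ d) conjgC (conjgM _ (ltr x)) ltrJ -conjgM.
Qed.

Lemma displ_comm_inj x : {in displ &, injective (fun d => [~ d, ltr x])}.
Proof.
set f := fun d => [~ d, ltr x].
have fM : {in displ &, {morph f : d e / d * e}}.
  move=> d e dD eD; rewrite /f !commgEl conjMg invMg.
  have dlD : d ^ ltr x \in displ by rewrite memJ_norm ?ltr_norm.
  have eC : commute e^-1 (d^-1 * d ^ ltr x).
    by apply: (centsP displ_abel); [rewrite groupV | rewrite groupM ?groupV].
  by rewrite mulgA -(mulgA e^-1) eC !mulgA.
(* By finiteness surjectivity onto [displ] suffices; the image of the morphism [f] is a group, so
   only generators need be reached. *)
apply/imset_injP; rewrite eqn_leq leq_imset_card /=; apply: subset_leq_card.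
have gf : group_set (f @: displ).
  apply/group_setP; split.
    by apply/imsetP; exists 1; rewrite // /f comm1g.
  move=> _ _ /imsetP[d dD ->] /imsetP[e eD ->].
  by rewrite -fM // imset_f // groupM.
rewrite -[f @: displ]/(gval (Group gf)) gen_subG.
apply/subsetP=> _ /imsetP[[y z] _ ->] /=.
have [[d dD ->] [e eD ->]] := (ltr_displ_conj x y, ltr_displ_conj x z).
have -> : (ltr x ^ d)^-1 * ltr x ^ e = (f d) * (f e)^-1.
  by rewrite /f commgEl !conjgE !invMg !invgK !mulgA mulgK.
by rewrite (groupM (G:=Group gf)) ?groupV /= ?imset_f.
Qed.

(** * The isomorphism with an affine product *)

Variable x0 : Q.

Definition conj_ltr : abelian_zmod displ_abel -> abelian_zmod displ_abel :=
  conj_zmod (ltr x0).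

HB.instance Definition _ := GRing.isZmodMorphism.Build _ _ conj_ltr
  (conj_zmod_additive (ltr_norm x0)).

Lemma conj_ltr_bij : bijective conj_ltr.
Proof. exact: conj_zmod_bij (ltr_norm x0). Qed.

Lemma sgval_conj_ltr a : sgval (conj_ltr a) = sgval a ^ ltr x0.
Proof. exact: sgval_conj (ltr_norm x0) a. Qed.

Lemma Fix_conj_ltr : Fix conj_ltr =i pred1 0%R.
Proof.
move=> a; rewrite !inE; apply/eqP/eqP => [fa|->]; last exact: raddf0.
apply/subg_inj/(displ_comm_inj (x := x0)); rewrite ?subgP ?group1 //.
by rewrite commgEl -sgval_conj_ltr fa mulVg /= comm1g.
Qed.

Local Notation n := (fingraph.order square x0).
Local Notation pow i := (iter i square x0).

Lemma ltr_pow i : ltr x0 (pow i) = pow i.+1.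
Proof. by rewrite -iter_square_aut ?ltr_aut // ltrE -iterSr. Qed.

Lemma pow_ordS (i : 'I_n) : pow (ordS i) = pow i.+1.
Proof.
rewrite [nat_of_ord _]/=; have [->|lt_in] := eqVneq i.+1 n.
  by rewrite modnn (iter_order square_inj).
by rewrite modn_small // ltn_neqAle lt_in ltn_ord.
Qed.

Definition displ_pow (p : abelian_zmod displ_abel * 'I_n) : Q :=
  sgval p.1 (pow p.2).

Lemma displ_powM p q :
  displ_pow (prod_op (aff (idfun \- conj_ltr)%R conj_ltr 0%R) (@Zn_succ n) p q)
  = mul (displ_pow p) (displ_pow q).
Proof.
case: p q => [d i] [e j].
(* In this order the conjugates cancel: both sides become [e * d^-1 * ltr x0 * d] applied to
   [pow j]. *)
have -> : prod_op (aff (idfun \- conj_ltr)%R conj_ltr 0%R) (@Zn_succ n)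
    (d, i) (e, j) = ((conj_ltr e - conj_ltr d + d)%R, ordS j).
  congr pair; rewrite /aff addr0 [LHS]addrC -addrA.
  by rewrite [in RHS](addrC (- _)%R).
rewrite /displ_pow /= -ltrE pow_ordS -ltr_pow.
have dA := subsetP displ_aut _ (subgP d).
rewrite (rack_autP _ dA) ltr_iter_square -!permM; congr (fun_of_perm _ _).
by rewrite !sgval_conj_ltr -conjVg !mulgA mulgV mul1g mulgK.
Qed.

Lemma displ_pow_inj : injective displ_pow.
Proof.
move=> [d i] [e j]; rewrite /displ_pow /= => eq_pow.
have dA := subsetP displ_aut _ (subgP d).
have eA := subsetP displ_aut _ (subgP e).
(* Squaring commutes with [d] and [e] while [ltr x0] conjugates them, and both raise the exponents
   by one. Hence [s] and [s ^ ltr x0] agree at a point, so they coincide by semiregularity. *)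
have eq_sq : sgval d (pow i.+1) = sgval e (pow j.+1).
  rewrite -(iter_square_aut 1 (pow i) dA) -(iter_square_aut 1 (pow j) eA).
  by rewrite eq_pow.
have eq_ltr : (sgval d ^ ltr x0) (pow i.+1) = (sgval e ^ ltr x0) (pow j.+1).
  by rewrite -!ltr_pow !permJ eq_pow.
pose s := sgval d * (sgval e)^-1.
have sD : s \in displ by rewrite groupM ?groupV ?subgP.
have s_pow : s (pow i.+1) = pow j.+1 by rewrite permM eq_sq permK.
have sJ_pow : (s ^ ltr x0) (pow i.+1) = pow j.+1.
  by rewrite conjMg conjVg permM eq_ltr permK.
have s_fix : s * (s ^ ltr x0)^-1 = 1.
  apply: (@displ_semiregular _ (pow i.+1)).
    by rewrite groupM ?groupV // memJ_norm ?ltr_norm.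
  by rewrite permM s_pow -sJ_pow permK.
have s1 : s = 1.
  apply: (displ_comm_inj (x := x0)); rewrite ?group1 //.
  by rewrite comm1g commgEl -(divg1_eq s_fix) mulVg.
have eq_de : d = e by apply/subg_inj/divg1_eq.
rewrite eq_de in eq_pow *; congr pair; apply: val_inj => /=.
by rewrite -(findex_iter (ltn_ord i)) (perm_inj eq_pow) findex_iter.
Qed.

Lemma displ_pow_surj y : exists p, displ_pow p == y.
Proof.
pose P z := [exists d in displ, exists i : 'I_n, z == (d : {perm Q}) (pow i)].
suffices /exists_inP[d dD /existsP[i /eqP ->]] : P y.
  by exists (subg displ d, i); rewrite /displ_pow /= subgK.
apply: (@connected_ind P x0) y => [|a z].
  apply/exists_inP; exists 1 => //; apply/existsP.
  by exists (Ordinal (fingraph.order_gt0 square x0)); rewrite perm1.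
case/exists_inP=> d dD /existsP[i /eqP ->]; apply/exists_inP.
(* Moving [ltr x0] to the left of [d] makes it act on [pow i], which raises the exponent by one. *)
exists (d ^ ltr x0 * ((ltr x0)^-1 * ltr a)).
  by rewrite groupM ?displ_gen // memJ_norm ?ltr_norm.
apply/existsP; exists (ordS i); apply/eqP.
rewrite pow_ordS -ltr_pow -!permM -ltrE -permM; congr (fun_of_perm _ _).
by rewrite mulgA -conjgC mulgA mulgK.
Qed.

Lemma isomorphic_prod_aff :
  isomorphic mul
    (prod_op (aff (idfun \- conj_ltr)%R conj_ltr 0%R) (@Zn_succ n)).
Proof.
pose h y := xchoose (displ_pow_surj y).
have hK : cancel h displ_pow.
  by move=> y; exact: eqP (xchooseP (displ_pow_surj y)).
have Kh : cancel displ_pow h := inj_can_sym hK displ_pow_inj.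
exists h; split=> [|x y]; first by exists displ_pow.
by apply: displ_pow_inj; rewrite displ_powM !hK.
Qed.

End LeftTranslations.

Theorem corollary4p10 (Q : finType) (mul ldiv : Q -> Q -> Q)
    (Q_rack : rack mul ldiv) (Q_conn : connected mul) :
  (medial mul <-> abelian_alg mul ldiv) /\
  (abelian_alg mul ldiv <->
    exists (A : zmodType) (f : {additive A -> A}) (n : nat),
      [/\ bijective f, Fix f =i pred1 0, (1 <= n)%N &
          isomorphic mul (prod_op (aff (idfun \- f) f 0) (@Zn_succ n))]).
Proof.
set affine := (X in _ /\ (_ <-> X)).
have abelian_medial := rack_abelian_medial Q_rack.
have medial_affine : medial mul -> affine.
  move=> mediQ; have cDD := medial_abelian_displ Q_rack mediQ.
  have [[[x0] _] _] := Q_rack.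
  exists (abelian_zmod cDD), (@conj_ltr _ _ _ _ cDD x0).
  exists (fingraph.order (square mul) x0); split.
  - exact: conj_ltr_bij.
  - exact: Fix_conj_ltr.
  - exact: fingraph.order_gt0.
  - exact: isomorphic_prod_aff.
have affine_abelian : affine -> abelian_alg mul ldiv.
  move=> [A [f [n [f_bij _ n_gt0 Qiso]]]].
  exact: prod_aff_abelian (proj1 Q_rack) (bij_inj f_bij) n_gt0 Qiso.
by split; split; auto.
Qed.
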